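(* The functor $gr_2Cat \to p_2Cat$ which sends $X \in gr_2Cat$ to $\mathcal F_{(X\setminus X_1)\cup \mathcal C_{X_1}} \in p_2Cat$ is left adjoint to the forgetful functor $p_2Cat \to gr_2Cat$.
   Context: Everything is small. For $n\ge 0$, an *$n$-categorically graded set* is a set $S$ with maps $s_i,t_i : S \to S$ for $0\le i<n$ such that, whenever $\sigma_i,\rho_i \in \{s_i,t_i\}$: (i) $\rho_i\sigma_i = \sigma_i$ for all $i$; (ii) for all $i<j$ and $\sigma_i\in\{s_i,t_i\}$, $\rho_j\in\{s_j,t_j\}$, $\rho_j\sigma_i=\sigma_i$ and $\sigma_i\rho_j=\sigma_i$. Morphisms are functions preserving all $s_i,t_i$; this gives the category $gr_nCat$. For $X\in gr_2Cat$, $X_1 := s_1X=t_1X$ is a 1-categorically graded set. A *pre-$n$-category* is an $n$-categorically graded set $\mathcal A$ together with compositions $*_i : \{(a,b)\in\mathcal A\times\mathcal A : s_i a = t_i b\}\to\mathcal A$ for $0\le i\le n-1$ such that $s_i(a*_i b)=s_i b$, $t_i(a*_i b)=t_i a$, and for $i<j$ and $\rho_j\in\{s_j,t_j\}$, $\rho_j(a*_i b)=\rho_j a *_i \rho_j b$. (No associativity, unit or interchange laws are required.) Morphisms are functions preserving all $s_i,t_i,*_i$; this gives the category $p_nCat$. *Free pre-1-category.* For $X_1\in gr_1Cat$, $\mathcal C_{X_1}\in p_1Cat$ is the pre-1-category of fully parenthesized composable formal words in $X_1$: $S_1=X_1$, $S_n=\bigsqcup_{1\le p\le n-1}\{x\bullet_0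 y : x\in S_p,\ y\in S_{n-p},\ s_0x=t_0y\}$, $\mathcal C_{X_1}=\bigsqcup_{n\ge1}S_n$, with $s_0(x\bullet_0y)=s_0y$, $t_0(x\bullet_0y)=t_0x$ and $x*_0y=x\bullet_0y$. *Free pre-2-category.* Given $\mathcal C\in p_1Cat$ and a set $X_2$ with maps $s_1,t_1:X_2\rightrightarrows\mathcal C$ satisfying $\sigma_0s_1=\sigma_0t_1$ for $\sigma_0\in\{s_0,t_0\}$, the disjoint union $X_2\cup\mathcal C$ is a 2-categorically graded set with $s_1=t_1=\mathrm{id}$ on $\mathcal C$ and $\sigma_0:=\sigma_0s_1$ on $X_2$. The pre-2-category $\mathcal F_{X_2\cup\mathcal C}$ is $\bigsqcup_{n\ge1}T_n$, where $T_1=X_2\sqcup\mathcal C$, $T_2$ is the set of formal words $x\bullet_iy$ with $i\in\{0,1\}$, $x,y\in T_1$, $s_ix=t_iy$, excluding words $x\bullet_0y$ with $x,y\in\mathcal C$, and for $n>2$, $T_n=\bigsqcup_{0<p<n}\{x\bullet_iy: i\in\{0,1\}, x\in T_p,y\in T_{n-p},s_ix=t_iy\}$. Its structure is $s_i(x\bullet_iy)=s_iy$, $t_i(x\bullet_iy)=t_ix$, $s_0(x\bullet_1y)=s_0y$, $t_0(x\bullet_1y)=t_0x$, $\sigma_1(x\bullet_0y)=\sigma_1x*_0\sigma_1y$ for $\sigma_1\in\{s_1,t_1\}$; $x*_1y=x\bullet_1y$; and $x*_0y$ is the composite in $\mathcal C$ if $x,y\in\mathcal C$, and $x\bullet_0y$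 otherwise. For $X\in gr_2Cat$, the maps $X\setminus X_1\rightrightarrows\mathcal C_{X_1}$ are the composites of $s_1,t_1:X\setminus X_1\to X_1$ with the inclusion $X_1\hookrightarrow\mathcal C_{X_1}$. *)

(* Defs.v *)
From mathcomp Require Import all_boot.
From mathcomp Require Import boolp classical_sets.

Set Implicit Arguments.
Unset Strict Implicit.
Unset Printing Implicit Defensive.

Local Open Scope classical_set_scope.

Record category := Category {
  ob :> Type;
  hom : ob -> ob -> Type;
  idm : forall a, hom a a;
  cmp : forall a b c, hom b c -> hom a b -> hom a c;
  cmp1m : forall a b (f : hom a b), cmp (idm b) f = f;
  cmpm1 : forall a b (f : hom a b), cmp f (idm a) = f;
  cmpA : forall a b c d (h : hom c d) (g : hom b c) (f : hom a b),
    cmp h (cmp g f) = cmp (cmp h g) f }.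

Record functor (C D : category) := Functor {
  fob :> C -> D;
  fmor : forall a b : C, hom a b -> hom (fob a) (fob b);
  fmor1 : forall a : C, fmor (idm a) = idm (fob a);
  fmorM : forall (a b c : C) (g : hom b c) (f : hom a b),
    fmor (cmp g f) = cmp (fmor g) (fmor f) }.

Definition left_adjoint (C D : category) (F : functor C D) (U : functor D C) : Prop :=
  exists Phi : forall (x : C) (a : D), hom (F x) a -> hom x (U a),
    [/\ forall x a, bijective (@Phi x a),
        forall (x y : C) (a : D) (f : hom x y) (g : hom (F y) a),
          Phi x a (cmp g (fmor F f)) = cmp (Phi y a g) f
      & forall (x : C) (a b : D) (h : hom a b) (g : hom (F x) a),
          Phi x b (cmp h g) = cmp (fmor U h) (Phi x a g)].

Variant side := src | tgt.

(* An n-categorically graded set: [bd src i] is s_i and [bd tgt i] is t_i. *)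
Record grset (n : nat) := GrSet {
  gcar :> Type;
  bd : side -> 'I_n -> gcar -> gcar;
  bd_same : forall (r e : side) (i : 'I_n) x, bd r i (bd e i x) = bd e i x;
  bd_hi_lo : forall (r e : side) (i j : 'I_n) x,
    i < j -> bd r j (bd e i x) = bd e i x;
  bd_lo_hi : forall (r e : side) (i j : 'I_n) x,
    i < j -> bd e i (bd r j x) = bd e i x }.

Record grhom (n : nat) (X Y : grset n) := GrHom {
  gfun :> X -> Y;
  gfun_bd : forall e i x, gfun (bd e i x) = bd e i (gfun x) }.

Lemma grhom_eq n (X Y : grset n) (f g : grhom X Y) : f =1 g -> f = g.
Proof.
case: f g => [f hf] [g hg] /= /funext fg; case: _ / fg hg => hg.
by congr GrHom; exact: Prop_irrelevance.
Qed.

Definition grhom_id n (X : grset n) : grhom X X :=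
  @GrHom n X X id (fun _ _ _ => erefl).

Lemma grhom_comp_bd n (X Y Z : grset n) (g : grhom Y Z) (f : grhom X Y) e i x :
  g (f (bd e i x)) = bd e i (g (f x)).
Proof. by rewrite !gfun_bd. Qed.

Definition grhom_comp n (X Y Z : grset n) (g : grhom Y Z) (f : grhom X Y) : grhom X Z :=
  @GrHom n X Z (fun x => g (f x)) (grhom_comp_bd g f).

Definition grCat (n : nat) : category.
Proof.
by refine (@Category (grset n) (@grhom n) (@grhom_id n) (@grhom_comp n) _ _ _) => *;
  apply: grhom_eq.
Defined.

Lemma bd_composable n (A : grset n) (i j : 'I_n) (r : side) (a b : A) :
  i < j -> bd src i a = bd tgt i b -> bd src i (bd r j a) = bd tgt i (bd r j b).
Proof. by move=> ij; rewrite !bd_lo_hi. Qed.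

(* Composition is defined on the pairs with s_i a = t_i b, hence its proof argument. *)
Record precat (n : nat) := PreCat {
  pgr :> grset n;
  comp : forall (i : 'I_n) (a b : pgr), bd src i a = bd tgt i b -> pgr;
  comp_src : forall i a b (e : bd src i a = bd tgt i b),
    bd src i (comp e) = bd src i b;
  comp_tgt : forall i a b (e : bd src i a = bd tgt i b),
    bd tgt i (comp e) = bd tgt i a;
  comp_bd : forall (i j : 'I_n) (ij : i < j) (r : side) a b
      (e : bd src i a = bd tgt i b),
    bd r j (comp e) = comp (bd_composable r ij e) }.

Lemma grhom_composable n (A B : grset n) (f : grhom A B) i a b :
  bd src i a = bd tgt i b -> bd src i (f a) = bd tgt i (f b).
Proof. by move=> e; rewrite -!gfun_bd e. Qed.

Record prehom (n : nat) (A B : precat n) := PreHom {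
  pgrhom :> grhom A B;
  phom_comp : forall i (a b : A) (e : bd src i a = bd tgt i b),
    pgrhom (comp e) = comp (grhom_composable pgrhom e) }.

Lemma prehom_eq n (A B : precat n) (f g : prehom A B) : f =1 g -> f = g.
Proof.
case: f g => [f hf] [g hg] /= /grhom_eq fg; case: _ / fg hg => hg.
by congr PreHom; exact: Prop_irrelevance.
Qed.

Lemma comp_bd_lo n (A : precat n) (i j : 'I_n) (e : side) (a b : A)
    (ab : bd src j a = bd tgt j b) : i < j ->
  bd e i (comp ab) = bd e i (if e is src then b else a).
Proof.
move=> ij; rewrite -(bd_lo_hi e e _ ij).
by case: e; rewrite ?comp_src ?comp_tgt bd_lo_hi.
Qed.

(* [comp] extended to all pairs by a junk value; it is only meant to be used
   on composable pairs, where [compdE] says that it is the composition. *)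
Definition compd n (A : precat n) (i : 'I_n) (a b : A) : A :=
  if pselect (bd src i a = bd tgt i b) is left e then comp e else a.

Lemma compdE n (A : precat n) i (a b : A) (e : bd src i a = bd tgt i b) :
  comp e = compd i a b.
Proof.
by rewrite /compd; case: pselect => // e'; congr comp; exact: Prop_irrelevance.
Qed.

Lemma prehom_compd n (A B : precat n) (f : prehom A B) i (a b : A) :
  bd src i a = bd tgt i b -> f (compd i a b) = compd i (f a) (f b).
Proof. by move=> e; rewrite -(compdE e) phom_comp compdE. Qed.

Definition prehom_id n (A : precat n) : prehom A A.
Proof.
by refine (@PreHom n A A (grhom_id A) _) => i a b e /=;
  congr comp; exact: Prop_irrelevance.
Defined.

Definition prehom_cmp n (A B C : precat n) (g : prehom B C) (f : prehom A B) : prehom A C.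
Proof.
by refine (@PreHom n A C (grhom_comp g f) _) => i a b e /=;
  rewrite !phom_comp; congr comp; exact: Prop_irrelevance.
Defined.

Definition pCat (n : nat) : category.
Proof.
by refine (@Category (precat n) (@prehom n) (@prehom_id n) (@prehom_cmp n) _ _ _) => *;
  apply: prehom_eq.
Defined.

Definition forgetful (n : nat) : functor (pCat n) (grCat n) :=
  @Functor (pCat n) (grCat n) (@pgr n) (fun A B f => @pgrhom n A B f)
    (fun _ => erefl) (fun _ _ _ _ _ => erefl).

Lemma sig_eq (T : Type) (P : T -> Prop) (x y : {z | P z}) : sval x = sval y -> x = y.
Proof.
case: x y => [x hx] [y hy] /= xy; case: _ / xy hy => hy.
by congr exist; exact: Prop_irrelevance.
Qed.

(* Binary trees of letters; S_n is the set of the composable ones that have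
   n leaves, so the disjoint union of the S_n is the set of composable trees. *)
Inductive word1 (T : Type) := Letter1 (x : T) | Node1 (u v : word1 T).

Fixpoint word1_map (S T : Type) (f : S -> T) (w : word1 S) : word1 T :=
  match w with
  | Letter1 x => Letter1 (f x)
  | Node1 u v => Node1 (word1_map f u) (word1_map f v)
  end.

Section Free1.
Variable X : grset 1.

Fixpoint word1_bd (e : side) (w : word1 X) : X :=
  match w with
  | Letter1 x => bd e ord0 x
  | Node1 u v => match e with src => word1_bd e v | tgt => word1_bd e u end
  end.

Fixpoint word1_wf (w : word1 X) : Prop :=
  match w with
  | Letter1 _ => True
  | Node1 u v => [/\ word1_wf u, word1_wf v & word1_bd src u = word1_bd tgt v]
  end.

Definition free1_car := {w : word1 X | word1_wf w}.

Definition free1_letter (x : X) : free1_car := exist word1_wf (Letter1 x) I.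

Lemma word1_bd_bd r e w : bd r ord0 (word1_bd e w) = word1_bd e w.
Proof. by elim: w => [x|u IHu v IHv] /=; [rewrite bd_same | case: e IHu IHv]. Qed.

Definition free1_gr : grset 1.
Proof.
refine (@GrSet 1 free1_car (fun e _ w => free1_letter (word1_bd e (sval w))) _ _ _).
- by move=> r e i w; apply: sig_eq; rewrite /= word1_bd_bd.
- by move=> r e i j; rewrite !ord1.
- by move=> r e i j; rewrite !ord1.
Defined.

Lemma free1_node_wf (i : 'I_1) (u v : free1_gr) :
  bd src i u = bd tgt i v -> word1_wf (Node1 (sval u) (sval v)).
Proof. by move=> [e]; split=> //; apply: svalP. Qed.

Definition free1 : precat 1.
Proof.
refine (@PreCat 1 free1_gr (fun i u v e => exist word1_wf _ (free1_node_wf e)) _ _ _) => //.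
by move=> i j; rewrite !ord1.
Defined.

End Free1.

Section Free1Map.
Variables (X Y : grset 1) (f : grhom X Y).

Lemma word1_bd_map e w : word1_bd e (word1_map f w) = f (word1_bd e w).
Proof. by elim: w => [x|u IHu v IHv] /=; [rewrite gfun_bd | case: e IHu IHv]. Qed.

Lemma word1_map_wf (w : word1 X) : word1_wf w -> word1_wf (word1_map f w).
Proof.
by elim: w => [//|u IHu v IHv] /= [/IHu hu /IHv hv e]; split=> //; rewrite !word1_bd_map e.
Qed.

Definition free1_map : prehom (free1 X) (free1 Y).
Proof.
unshelve refine (@PreHom 1 (free1 X) (free1 Y) (@GrHom 1 (free1 X) (free1 Y)
  (fun w => exist (@word1_wf Y) (word1_map f (sval w)) (word1_map_wf (svalP w))) _) _).
- by move=> e i w; apply: sig_eq; rewrite /= word1_bd_map.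
- by move=> i a b e; apply: sig_eq.
Defined.

End Free1Map.

Lemma free1_map_id (X : grset 1) (f : grhom X X) : f =1 id -> free1_map f =1 id.
Proof.
move=> fE [w hw]; apply: sig_eq => /=.
by elim: w {hw} => [x|u + v +] /=; [rewrite fE | move=> -> ->].
Qed.

Lemma free1_map_comp (X Y Z : grset 1) (g : grhom Y Z) (f : grhom X Y) (h : grhom X Z) :
  (forall x, h x = g (f x)) -> forall w, free1_map h w = free1_map g (free1_map f w).
Proof.
move=> hE [w hw]; apply: sig_eq => /=.
by elim: w {hw} => [x|u + v +] /=; [rewrite hE | move=> -> ->].
Qed.

Notation i0 := (ord0 : 'I_2).
Notation i1 := (ord_max : 'I_2).

(* The letters are the elements of X2 + C.  The operations s_i, t_i of the
   graded set that is constructed take their values in C, and [letter_bd],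
   [word2_bd] return the value as an element of C. *)
Inductive word2 (T : Type) := Letter2 (z : T) | Node2 (i : 'I_2) (u v : word2 T).

(* C is a pre-1-category and X2 a set over it, with s_1 = b1 src, t_1 = b1 tgt. *)
Section Free2.
Variables (C : precat 1) (X2 : Type) (b1 : side -> X2 -> C).
Hypothesis b1_glob : forall e x, bd e ord0 (b1 src x) = bd e ord0 (b1 tgt x).

Definition letter_bd (e : side) (i : 'I_2) (z : X2 + C) : C :=
  match z with
  | inl x => if i == i0 then bd e ord0 (b1 src x) else b1 e x
  | inr c => if i == i0 then bd e ord0 c else c
  end.

(* The last case is i = 1, j = 0; on well-formed words [compd] is applied to
   composable pairs, see [word2_bd_composable]. *)
Fixpoint word2_bd (e : side) (i : 'I_2) (w : word2 (X2 + C)) : C :=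
  match w with
  | Letter2 z => letter_bd e i z
  | Node2 j u v =>
      if i <= j then match e with src => word2_bd e i v | tgt => word2_bd e i u end
      else compd ord0 (word2_bd e i u) (word2_bd e i v)
  end.

Definition in_base (w : word2 (X2 + C)) : bool :=
  if w is Letter2 (inr _) then true else false.

(* T_n is the set of well-formed words with n leaves. *)
Fixpoint word2_wf (w : word2 (X2 + C)) : Prop :=
  match w with
  | Letter2 _ => True
  | Node2 i u v =>
      [/\ word2_wf u, word2_wf v, word2_bd src i u = word2_bd tgt i v
        & ~~ [&& i == i0, in_base u & in_base v]]
  end.

Definition free2_car := {w : word2 (X2 + C) | word2_wf w}.

Definition free2_letter (z : X2 + C) : free2_car := exist word2_wf (Letter2 z) I.

Lemma letter_bd0 r e z : bd r ord0 (letter_bd e i1 z) = letter_bd r i0 z.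
Proof. by case: z => [x|c] //=; case: e. Qed.

Lemma letter_bd00 r e z : bd r ord0 (letter_bd e i0 z) = letter_bd e i0 z.
Proof. by case: z => [x|c] /=; rewrite bd_same. Qed.

Lemma ord2P (i : 'I_2) : i = i0 \/ i = i1.
Proof. by case: i => [[|[|//]]] h; [left | right]; apply: val_inj. Qed.

Lemma word2_bd00 r e w : bd r ord0 (word2_bd e i0 w) = word2_bd e i0 w.
Proof. by elim: w => [z|j u IHu v IHv] /=; [apply: letter_bd00 | case: e IHu IHv]. Qed.

Lemma word2_bd0 r e w : word2_wf w ->
  bd r ord0 (word2_bd e i1 w) = word2_bd r i0 w.
Proof.
elim: w r e => [z|j u IHu v IHv] r e /=; first by rewrite letter_bd0.
case=> hu hv uv _; case: (ord2P j) uv => -> /= uv; last first.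
  case: e r => -[]; rewrite ?IHu ?IHv //.
    by rewrite -(IHv tgt tgt) // -uv IHu.
  by rewrite -(IHu src src) // uv IHv.
have E : bd src ord0 (word2_bd e i1 u) = bd tgt ord0 (word2_bd e i1 v).
  by rewrite IHu // IHv.
by rewrite -(compdE E); case: r; rewrite ?comp_src ?comp_tgt ?IHu ?IHv.
Qed.

Lemma word2_bd_composable e u v : word2_wf u -> word2_wf v ->
  word2_bd src i0 u = word2_bd tgt i0 v ->
  bd src ord0 (word2_bd e i1 u) = bd tgt ord0 (word2_bd e i1 v).
Proof. by move=> hu hv uv; rewrite !word2_bd0. Qed.

Definition free2_gr : grset 2.
Proof.
refine (@GrSet 2 free2_car
  (fun e i w => free2_letter (inr (word2_bd e i (sval w)))) _ _ _).
- move=> r e i [w hw]; apply: sig_eq => /=; congr (Letter2 (inr _)).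
  by case: (ord2P i) => -> //=; exact: word2_bd00.
- move=> r e i j [w hw] ij; apply: sig_eq => /=; congr (Letter2 (inr _)).
  by case: (ord2P i) ij => ->; case: (ord2P j) => -> //=.
- move=> r e i j [w hw] ij; apply: sig_eq => /=; congr (Letter2 (inr _)).
  by case: (ord2P i) ij => ->; case: (ord2P j) => -> //= _; exact: word2_bd0.
Defined.

Definition word2_comp (i : 'I_2) (u v : word2 (X2 + C)) : word2 (X2 + C) :=
  match u, v with
  | Letter2 (inr c), Letter2 (inr d) =>
      if i == i0 then Letter2 (inr (compd ord0 c d)) else Node2 i u v
  | _, _ => Node2 i u v
  end.

Lemma word2_compE i u v : ~~ [&& i == i0, in_base u & in_base v] ->
  word2_comp i u v = Node2 i u v.
Proof. by case: u v => [[x|c]|k u1 u2] [[y|d]|l v1 v2] //=; case: eqP. Qed.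

Lemma word2_comp_bd e i j u v : word2_bd src j u = word2_bd tgt j v ->
  word2_bd e i (word2_comp j u v) = word2_bd e i (Node2 j u v).
Proof.
case: (boolP [&& j == i0, in_base u & in_base v]) => [|/word2_compE -> //].
case: u v => [[x|c]|k u1 u2] [[y|d]|l v1 v2] /and3P[] //= /eqP -> _ _ /= cd.
by case: (ord2P i) => -> //=; rewrite -(compdE cd); case: e; rewrite ?comp_src ?comp_tgt.
Qed.

Lemma word2_comp_wf (i : 'I_2) (u v : free2_gr) :
  bd src i u = bd tgt i v -> word2_wf (word2_comp i (sval u) (sval v)).
Proof.
move: u v => [u hu] [v hv] [] /= uv.
case: (boolP [&& i == i0, in_base u & in_base v]) => [|ne]; last first.
  by rewrite word2_compE.
by case: u v {hu hv uv} => [[x|c]|k u1 u2] [[y|d]|l v1 v2] /and3P[] //= ->.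
Qed.

Definition free2 : precat 2.
Proof.
refine (@PreCat 2 free2_gr (fun i u v e => exist word2_wf _ (word2_comp_wf e)) _ _ _).
- move=> i [u hu] [v hv] e; apply: sig_eq; case: (e) => /= e'.
  by rewrite word2_comp_bd //= leqnn.
- move=> i [u hu] [v hv] e; apply: sig_eq; case: (e) => /= e'.
  by rewrite word2_comp_bd //= leqnn.
- move=> i j ij r [u hu] [v hv] e; apply: sig_eq; case: (e) => /= e'.
  rewrite word2_comp_bd //=.
  by case: (ord2P i) ij e' => ->; case: (ord2P j) => -> //=.
Defined.

End Free2.

Section Dim1.
Variable X : grset 2.

Definition dim1 : set X := range (bd src i1).

Lemma dim1E : dim1 = range (bd tgt i1).
Proof.
by apply/seteqP; split=> _ [x _ <-]; [exists (bd src i1 x) | exists (bd tgt i1 x)];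
  rewrite ?bd_same.
Qed.

Lemma dim1P x e : dim1 x -> bd e i1 x = x.
Proof. by move=> [y _ <-]; rewrite bd_same. Qed.

Lemma dim1_bd e i x : bd e i x \in dim1.
Proof.
apply: mem_set; exists (bd e i x) => //.
by case: (ord2P i) => ->; [rewrite bd_hi_lo | rewrite bd_same].
Qed.

Definition dim1_gr : grset 1.
Proof.
refine (@GrSet 1 dim1
  (fun e i x => SigSub (dim1_bd e (widen_ord (leqnSn 1) i) (val x))) _ _ _).
- by move=> r e i x; apply: val_inj; rewrite /= bd_same.
- by move=> r e i j x; rewrite !ord1.
- by move=> r e i j x; rewrite !ord1.
Defined.

Definition free_b1 (e : side) (x : ~` dim1) : free1 dim1_gr :=
  free1_letter (SigSub (dim1_bd e i1 (val x)) : dim1_gr).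

Lemma free_b1_glob e x : bd e ord0 (free_b1 src x) = bd e ord0 (free_b1 tgt x).
Proof.
by apply: sig_eq; congr Letter1; apply: val_inj; rewrite /= !bd_lo_hi.
Qed.

(* F_{(X \ X_1) u C_{X_1}} *)
Definition free_ob : precat 2 := free2 free_b1_glob.

(* An element of X_1 is included through C_{X_1}, as a word of length 1. *)
Definition free_incl (x : X) : free_ob :=
  free2_letter free_b1
    match pselect (dim1 x) with
    | left x1 => inr (free1_letter (SigSub (mem_set x1) : dim1_gr))
    | right x2 => inl (SigSub (mem_set (x2 : (~` dim1) x)))
    end.

End Dim1.

Arguments dim1 X : clear implicits.

Section FreeMap.
Variables (X Y : grset 2) (f : grhom X Y).

Lemma dim1_map (x : dim1 X) : f (val x) \in dim1 Y.
Proof. by case: x => x /= /set_mem[y _ <-]; rewrite gfun_bd dim1_bd. Qed.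

Definition dim1_grhom : grhom (dim1_gr X) (dim1_gr Y).
Proof.
refine (@GrHom 1 (dim1_gr X) (dim1_gr Y) (fun x => SigSub (dim1_map x)) _).
by move=> e i x; apply: val_inj; rewrite /= gfun_bd.
Defined.

(* f is applied letterwise and the resulting word is evaluated in the target:
   an element of X \ X_1 may be sent to an element of Y_1, which can make some
   formal 0-composites become composites of C_{Y_1}. *)
Fixpoint free_map_word (w : word2 (~` dim1 X + free1 (dim1_gr X))) : free_ob Y :=
  match w with
  | Letter2 (inl x) => free_incl (f (val x))
  | Letter2 (inr c) => free2_letter (@free_b1 Y) (inr (free1_map dim1_grhom c))
  | Node2 i u v => compd i (free_map_word u) (free_map_word v)
  end.

End FreeMap.

Section FreeMor.
Variables (X Y : grset 2) (f : grhom X Y).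
Let L := (~` dim1 X + free1 (dim1_gr X))%type.
Let cst (c : free1 (dim1_gr X)) : free_ob Y :=
  free2_letter (@free_b1 Y) (inr (free1_map (dim1_grhom f) c)).

Lemma free_incl_bd e i (y : Y) : free_incl (bd e i y) = bd e i (free_incl y).
Proof.
apply: sig_eq => /=; case: pselect => [h1|[]]; last exact/set_mem/dim1_bd.
congr (Letter2 (inr _)); apply: sig_eq => /=; case: pselect => h2 /=.
  case: (ord2P i) h1 => -> h1 /=; congr Letter1; apply: val_inj => /=.
    by congr (bd e _ y); exact: val_inj.
  exact: dim1P.
case: (ord2P i) h1 => -> h1 /=; congr Letter1; apply: val_inj => //=.
by rewrite bd_lo_hi //; congr (bd e _ y); exact: val_inj.
Qed.

Lemma free_map_word_bd e i (w : word2 L) : word2_wf (@free_b1 X) w ->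
  bd e i (free_map_word f w) = cst (word2_bd (@free_b1 X) e i w).
Proof.
elim: w e i => [[x|c]|j u IHu v IHv] e i.
- move=> _; rewrite [free_map_word _ _]/= -free_incl_bd -gfun_bd; apply: sig_eq => /=.
  case: pselect => [h1|[]]; last by rewrite gfun_bd; exact/set_mem/dim1_bd.
  congr (Letter2 (inr _)); apply: sig_eq => /=.
  case: (ord2P i) h1 => -> h1 /=; congr Letter1; apply: val_inj => //=.
  by rewrite bd_lo_hi //; congr (f (bd e _ _)); exact: val_inj.
- move=> _; apply: sig_eq => /=; congr (Letter2 (inr _)).
  case: (ord2P i) => -> /=; last by [].
  by apply: sig_eq; rewrite /= (word1_bd_map (dim1_grhom f)).
case=> hu hv uv _; rewrite [free_map_word _ _]/= [word2_bd _ _ _ _]/=.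
have E : bd src j (free_map_word f u) = bd tgt j (free_map_word f v).
  by rewrite IHu // IHv // uv.
rewrite -(compdE E); case: (ltngtP i j) => [ij|ji|/val_inj ij].
- by rewrite comp_bd_lo //; case: e; rewrite ?IHu ?IHv.
- have [i_1 j_0] : i = i1 /\ j = i0.
    by case: (ord2P i) ji => ->; case: (ord2P j) => ->.
  rewrite {}i_1 {}j_0 in ji E uv *.
  rewrite comp_bd compdE !IHu // !IHv //.
  have uv1 := word2_bd_composable (@free_b1_glob X) e hu hv uv.
  have E1 : bd src i0 (cst (word2_bd (@free_b1 X) e i1 u)) =
            bd tgt i0 (cst (word2_bd (@free_b1 X) e i1 v)).
    by apply: sig_eq; congr (Letter2 (inr _));
      exact: (grhom_composable (free1_map (dim1_grhom f)) uv1).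
  by rewrite -(compdE E1) /cst prehom_compd //; apply: sig_eq.
- by case: _ / ij E uv => E uv; case: e; rewrite ?comp_src ?comp_tgt ?IHu ?IHv.
Qed.

Lemma free_map_bd e i (w : free_ob X) :
  free_map_word f (sval (bd e i w)) = bd e i (free_map_word f (sval w)).
Proof. by rewrite (free_map_word_bd _ _ (svalP w)). Qed.

Definition free_map_gr : grhom (free_ob X) (free_ob Y) :=
  @GrHom 2 (free_ob X) (free_ob Y) (fun w => free_map_word f (sval w)) free_map_bd.

Lemma free_map_comp i (a b : free_ob X) (e : bd src i a = bd tgt i b) :
  free_map_gr (comp e) = comp (grhom_composable free_map_gr e).
Proof.
rewrite [RHS]compdE; have := grhom_composable free_map_gr e.
case: a b e => [u hu] [v hv] e E.
case: (boolP [&& i == i0, in_base u & in_base v]) => [|ne]; last first.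
  by rewrite /= word2_compE.
case: u v hu hv e E => [[x|c]|k u1 u2] [[y|d]|l v1 v2] hu hv e E /and3P[] // /eqP i_0 _ _.
rewrite {}i_0 in e E *.
have cd : bd src ord0 c = bd tgt ord0 d by case: e => cd; apply: sig_eq; rewrite /= cd.
rewrite -(compdE E); apply: sig_eq; congr (Letter2 (inr _)).
exact: (prehom_compd (free1_map (dim1_grhom f)) cd).
Qed.

Definition free_map : prehom (free_ob X) (free_ob Y) := PreHom free_map_comp.

End FreeMor.

Lemma free_map_incl (X Y : grset 2) (f : grhom X Y) (x : X) :
  free_map f (free_incl x) = free_incl (f x).
Proof.
rewrite /= /free_incl; case: pselect => [h|//] /=.
case: pselect => [h'|[]]; last by apply/set_mem/(dim1_map f (SigSub (mem_set h))).
by apply: sig_eq; congr (Letter2 (inr _)); apply: sig_eq; congr Letter1; apply: val_inj.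
Qed.

Lemma free_map_id (X : grset 2) : free_map (grhom_id X) = prehom_id (free_ob X).
Proof.
apply: prehom_eq => -[w hw] /=.
elim: w hw => [[x|c]|i u IHu v IHv] hw /=.
- rewrite /free_incl; apply: sig_eq => /=; case: x hw => x hx /= _.
  case: pselect => [h|h]; first by case: (set_mem hx).
  by congr (Letter2 (inl _)); exact: val_inj.
- apply: sig_eq; congr (Letter2 (inr _)).
  by apply: (free1_map_id (f := dim1_grhom (grhom_id X))) => z; exact: val_inj.
case: (hw) => hu hv uv ne; rewrite (IHu hu) (IHv hv).
have E : bd src i (exist _ u hu : free_ob X) = bd tgt i (exist _ v hv : free_ob X).
  by apply: sig_eq; rewrite /= uv.
by rewrite -(compdE E); apply: sig_eq; rewrite /= word2_compE.
Qed.

Lemma free_map_cmp (X Y Z : grset 2) (g : grhom Y Z) (f : grhom X Y) :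
  free_map (grhom_comp g f) = prehom_cmp (free_map g) (free_map f).
Proof.
apply: prehom_eq => -[w hw].
elim: w hw => [[x|c]|i u IHu v IHv] hw.
- by have := free_map_incl g (f (val x)) => /= ->.
- apply: sig_eq => /=; congr (Letter2 (inr _)).
  by apply: (free1_map_comp (g := dim1_grhom g) (f := dim1_grhom f)
    (h := dim1_grhom (grhom_comp g f))) => z; exact: val_inj.
case: (hw) => hu hv uv ne; move: (IHu hu) (IHv hv) => /= -> ->.
have E : bd src i (exist _ u hu : free_ob X) = bd tgt i (exist _ v hv : free_ob X).
  by apply: sig_eq; rewrite /= uv.
have E' := grhom_composable (free_map f) E.
exact: esym (prehom_compd (free_map g) E').
Qed.

Definition free_functor : functor (grCat 2) (pCat 2) :=
  @Functor (grCat 2) (pCat 2) free_ob free_map free_map_id free_map_cmp.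

(* Main.v *)
Require Import Defs.
From mathcomp Require Import all_boot.
From mathcomp Require Import boolp classical_sets.
(* Makes [comp] denote composition in a pre-category again, not that of functions. *)
Import Defs.

(** The insertion of letters [free_incl : X -> free_ob X] is natural in [X], so
    precomposing with it sends [free_ob X -> A] to [X -> A] naturally in [X] and
    in [A]; the adjunction says that it is a universal arrow.  Universality is
    obtained from the universal properties of the two stages of the construction.

    Both stages can be compared with a pre-2-category [A] because [A] has an
    underlying pre-1-category [low A]: all the elements of [A], with [s_0], [t_0]
    and the 0-composition only.  A morphism [free1 Y -> B] is the same thing as a
    morphism [Y -> B] of graded sets ([free1_eval], [free1_hom_ext]): a word is
    evaluated by performing its compositions in [B].  A morphism to [A] from the
    [free2] on [C] and [X2] is the same thing as a morphism [k : C -> low A] whose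
    values are fixed by [s_1] and [t_1], together with a map [f : X2 -> A] whose
    1-boundary is the image under [k] of the given one ([free2_eval],
    [free2_hom_ext]).

    For [X] in the statement, a morphism [h : X -> A] restricts to [X_1], which
    gives [k] on [C = free1 X_1], and to [X \ X_1], which gives [f].  That [k] takes
    values fixed by [s_1] and [t_1] holds since [s_1] and [t_1] preserve
    0-composition, so that they are endomorphisms of [low A], and they fix the
    values of [h] on [X_1]. *)

Set Implicit Arguments.
Unset Strict Implicit.
Unset Printing Implicit Defensive.

(** * The underlying pre-1-category of a pre-2-category *)

Definition low_gr (X : grset 2) : grset 1.
Proof.
refine (@GrSet 1 X (fun e _ x => bd e i0 x) _ _ _).
- by move=> r e i x; rewrite bd_same.
- by move=> r e i j; rewrite !ord1.
- by move=> r e i j; rewrite !ord1.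
Defined.

Definition low (A : precat 2) : precat 1.
Proof.
refine (@PreCat 1 (low_gr A) (fun i a b e => @comp 2 A i0 a b e) _ _ _).
- by move=> i a b e; apply: comp_src.
- by move=> i a b e; apply: comp_tgt.
- by move=> i j; rewrite !ord1.
Defined.

Definition low_map (A B : precat 2) (p : prehom A B) : prehom (low A) (low B).
Proof.
refine (@PreHom 1 (low A) (low B)
  (@GrHom 1 (low A) (low B) p (fun e _ x => gfun_bd p e i0 x)) _).
by move=> i a b e; rewrite /= phom_comp; congr comp; exact: Prop_irrelevance.
Defined.

(** The axiom [comp_bd], for 0-composition and the 1-boundaries, in the form of a
    morphism: uniqueness of morphisms then applies to it. *)
Definition low_bd1 (A : precat 2) (e : side) : prehom (low A) (low A).
Proof.
unshelve refine (@PreHom 1 (low A) (low A) (@GrHom 1 (low A) (low A) (bd e i1) _) _).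
- by move=> r i x; rewrite /= bd_hi_lo // bd_lo_hi.
- by move=> i a b ab; rewrite /= comp_bd; congr comp; exact: Prop_irrelevance.
Defined.

(** * The universal property of the free pre-1-category *)

Section Free1Eval.
Variables (Y : grset 1) (B : precat 1).

Lemma free1_hom_ext (p q : prehom (free1 Y) B) :
  (forall y, p (free1_letter y) = q (free1_letter y)) -> p =1 q.
Proof.
move=> pq [w hw]; elim: w hw => [y|u IHu v IHv] hw.
  by rewrite (_ : exist _ _ _ = free1_letter y) //; apply: sig_eq.
case: (hw) => hu hv uv.
have E : bd src ord0 (exist _ u hu : free1 Y) = bd tgt ord0 (exist _ v hv : free1 Y).
  by apply: sig_eq; rewrite /= uv.
rewrite (_ : exist _ _ _ = comp E); last exact: sig_eq.
by rewrite compdE !prehom_compd // IHu IHv.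
Qed.

Variable f : grhom Y B.

Fixpoint word1_eval (w : word1 Y) : B :=
  match w with
  | Letter1 y => f y
  | Node1 u v => compd ord0 (word1_eval u) (word1_eval v)
  end.

Lemma word1_eval_bd e w : word1_wf w ->
  bd e ord0 (word1_eval w) = f (word1_bd e w).
Proof.
elim: w e => [y|u IHu v IHv] e /=; first by rewrite gfun_bd.
case=> hu hv uv.
have E : bd src ord0 (word1_eval u) = bd tgt ord0 (word1_eval v).
  by rewrite IHu // IHv // uv.
by rewrite -(compdE E); case: e; rewrite ?comp_src ?comp_tgt ?IHu ?IHv.
Qed.

Definition free1_eval : prehom (free1 Y) B.
Proof.
unshelve refine (@PreHom 1 (free1 Y) B
  (@GrHom 1 (free1 Y) B (fun w => word1_eval (sval w)) _) _).
- by move=> e i [w hw]; rewrite ord1 /= word1_eval_bd.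
- by move=> i a b e; rewrite [RHS]compdE /= (ord1 i).
Defined.

End Free1Eval.

(** * The universal property of the free pre-2-category over a pre-1-category *)

Section Free2Eval.
Variables (C : precat 1) (X2 : Type) (b1 : side -> X2 -> C).
Hypothesis b1_glob : forall e x, bd e ord0 (b1 src x) = bd e ord0 (b1 tgt x).
Variable A : precat 2.

Local Notation F2 := (free2 b1_glob).
Local Notation letter z := (free2_letter b1 z : F2).

(** The 0-composite of two letters of [C] is their composite in [C], not a formal
    one. *)
Definition free2_base : prehom C (low F2).
Proof.
unshelve refine (@PreHom 1 C (low F2)
  (@GrHom 1 C (low F2) (fun c => letter (inr c)) _) _).
- by move=> e i c; rewrite ord1; apply: sig_eq.
- move=> i a b; rewrite ord1 => e; apply: sig_eq => /=.
  by rewrite compdE.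
Defined.

Lemma free2_hom_ext (p q : prehom F2 A) :
  (forall z, p (letter z) = q (letter z)) -> p =1 q.
Proof.
move=> pq [w hw]; elim: w hw => [z|i u IHu v IHv] hw.
  by rewrite (_ : exist _ _ _ = letter z) //; apply: sig_eq.
case: (hw) => hu hv uv ne.
have E : bd src i (exist _ u hu : F2) = bd tgt i (exist _ v hv : F2).
  by apply: sig_eq; rewrite /= uv.
rewrite (_ : exist _ _ _ = comp E); last by apply: sig_eq; rewrite /= word2_compE.
by rewrite compdE !prehom_compd // IHu IHv.
Qed.

Variables (k : prehom C (low A)) (f : X2 -> A).
Hypothesis k_bd1 : forall e c, bd e i1 (k c : A) = k c.
Hypothesis f_bd1 : forall e x, bd e i1 (f x) = k (b1 e x).

Fixpoint word2_eval (w : word2 (X2 + C)) : A :=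
  match w with
  | Letter2 (inl x) => f x
  | Letter2 (inr c) => k c
  | Node2 i u v => compd i (word2_eval u) (word2_eval v)
  end.

Lemma word2_eval_bd e i w : word2_wf b1 w ->
  bd e i (word2_eval w) = k (word2_bd b1 e i w).
Proof.
have k_bd0 r c : k (bd r ord0 c) = bd r i0 (k c : A) by exact: (gfun_bd k).
elim: w e i => [[x|c]|j u IHu v IHv] e i.
- by case: (ord2P i) => -> _ //=; rewrite k_bd0 -f_bd1 bd_lo_hi.
- by case: (ord2P i) => -> _ //=.
case=> hu hv uv _; rewrite [word2_eval _]/= [word2_bd _ _ _ _]/=.
have E : bd src j (word2_eval u) = bd tgt j (word2_eval v).
  by rewrite IHu // IHv // uv.
rewrite -(compdE E); case: (ltngtP i j) => [ij|ji|/val_inj ij].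
- by rewrite comp_bd_lo //; case: e; rewrite ?IHu ?IHv.
- (* The 1-boundary of a 0-composite is a 0-composite of 1-boundaries, formed in
     [C] and then mapped by [k]. *)
  have [i_1 j_0] : i = i1 /\ j = i0.
    by case: (ord2P i) ji => ->; case: (ord2P j) => ->.
  rewrite {}i_1 {}j_0 in ji E uv *.
  rewrite comp_bd compdE !IHu // !IHv //.
  by rewrite (prehom_compd k (word2_bd_composable b1_glob e hu hv uv)).
- by case: _ / ij E uv => E uv; case: e; rewrite ?comp_src ?comp_tgt ?IHu ?IHv.
Qed.

Definition free2_eval : prehom F2 A.
Proof.
unshelve refine (@PreHom 2 F2 A
  (@GrHom 2 F2 A (fun w => word2_eval (sval w)) _) _).
- by move=> e i [w hw]; rewrite /= word2_eval_bd.
move=> i [u hu] [v hv] e; rewrite [RHS]compdE.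
case: (boolP [&& i == i0, in_base u & in_base v]) => [|ne]; last first.
  by rewrite /= word2_compE.
case: u v hu hv e => [[x|c]|? ? ?] [[y|d]|? ? ?] hu hv e /and3P[] // /eqP i_0 _ _.
rewrite {}i_0 in e *; case: (e) => cd.
exact: (prehom_compd k cd).
Defined.

End Free2Eval.

(** * The free pre-2-category on a graded set *)

Section FreeEval.
Variables (X : grset 2) (A : precat 2).

Lemma free_incl_dim1 (x : dim1 X) :
  free_incl (val x) = free2_letter (@free_b1 X) (inr (free1_letter (x : dim1_gr X))).
Proof.
rewrite /free_incl; case: pselect => [h|[]]; last exact/set_mem/valP.
apply: sig_eq; congr (Letter2 (inr _)); apply: sig_eq; congr Letter1.
exact: val_inj.
Qed.

Lemma free_incl_dim2 (x : (~` dim1 X)%classic) :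
  free_incl (val x) = free2_letter (@free_b1 X) (inl x).
Proof.
rewrite /free_incl; case: pselect => [h|h]; first by case: (set_mem (valP x)).
by apply: sig_eq; congr (Letter2 (inl _)); exact: val_inj.
Qed.

Definition free_unit : grhom X (free_ob X) :=
  @GrHom 2 X (free_ob X) (@free_incl X) (@free_incl_bd X).

(** On the letters from [free1 X_1] two such morphisms agree by the uniqueness part
    of the universal property of [free1], applied to their restrictions along
    [free2_base]. *)
Lemma free_hom_ext (p q : prehom (free_ob X) A) :
  (forall x, p (free_incl x) = q (free_incl x)) -> p = q.
Proof.
move=> pq; apply/prehom_eq/free2_hom_ext => -[x|c].
  by rewrite -free_incl_dim2.
pose base := free2_base (@free_b1_glob X).
apply: (free1_hom_ext (p := prehom_cmp (low_map p) base)
                      (q := prehom_cmp (low_map q) base)) => y.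
by rewrite /= -free_incl_dim1.
Qed.

Variable h : grhom X A.

Definition dim1_restrict : grhom (dim1_gr X) (low A).
Proof.
refine (@GrHom 1 (dim1_gr X) (low A) (fun x => h (val x)) _).
by move=> e i x /=; rewrite gfun_bd; congr bd; apply: val_inj; rewrite /= ord1.
Defined.

Lemma dim1_eval_bd1 e c :
  bd e i1 (free1_eval dim1_restrict c : A) = free1_eval dim1_restrict c.
Proof.
apply: (free1_hom_ext (p := prehom_cmp (low_bd1 A e) (free1_eval dim1_restrict))) => x.
by rewrite /= -gfun_bd (dim1P _ (set_mem (valP x))).
Qed.

Lemma dim2_eval_bd1 e (x : (~` dim1 X)%classic) :
  bd e i1 (h (val x)) = free1_eval dim1_restrict (free_b1 e x).
Proof. by rewrite /= gfun_bd. Qed.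

Definition free_eval : prehom (free_ob X) A :=
  free2_eval (@free_b1_glob X) dim1_eval_bd1 dim2_eval_bd1.

Lemma free_eval_incl x : free_eval (free_incl x) = h x.
Proof. by rewrite /= /free_incl; case: pselect. Qed.

End FreeEval.

Theorem corollary2p3 : left_adjoint free_functor (forgetful 2).
Proof.
exists (fun X A (g : prehom (free_ob X) A) => grhom_comp g (free_unit X)); split.
- move=> X A; exists (@free_eval X A) => [g|h].
    by apply: free_hom_ext => x; rewrite free_eval_incl.
  by apply: grhom_eq => x; exact: free_eval_incl.
- move=> X Y A f g; apply: grhom_eq => x.
  by have /= -> := free_map_incl f x.
- by move=> X A B g f; apply: grhom_eq.
Qed.
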